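(* Let $\alpha,\beta,\gamma\in\mathbb{R}$ and let $G_3$ be the connected, simply connected three-dimensional Lie group with left-invariant Lorentzian metric $g$ whose Lie algebra has a pseudo-orthonormal basis $\{\widetilde e_1,\widetilde e_2,\widetilde e_3\}$, with $\widetilde e_3$ timelike, satisfying $$[\widetilde e_1,\widetilde e_2]=-\gamma\widetilde e_3,\quad [\widetilde e_1,\widetilde e_3]=-\beta\widetilde e_2,\quad [\widetilde e_2,\widetilde e_3]=\alpha\widetilde e_1.$$ Then the symmetrized Ricci tensor $\widetilde\rho^k$ of the Kobayashi-Nomizu connection $\nabla^k$ is a Codazzi tensor on $(G_3,\nabla^k)$.
   Context: Basis vectors are identified with left-invariant vector fields on the group $G$; $g(\widetilde e_1,\widetilde e_1)=g(\widetilde e_2,\widetilde e_2)=1$, $g(\widetilde e_3,\widetilde e_3)=-1$, and $g(\widetilde e_i,\widetilde e_j)=0$ for $i\ne j$. Let $\nabla^L$ be the Levi-Civita connection of $g$ and $J$ the product structure on $G$ (a $(1,1)$ tensor field) with $J\widetilde e_1=\widetilde e_1$, $J\widetilde e_2=\widetilde e_2$, $J\widetilde e_3=-\widetilde e_3$. Put $(\nabla^L_XJ)Y=\nabla^L_X(JY)-J\nabla^L_XY$. The canonical connection is $\nabla^c_XY=\nabla^L_XY-\tfrac12(\nabla^L_XJ)JY$, and the Kobayashi-Nomizu connection is $\nabla^k_XY=\nabla^c_XY-\tfrac14[(\nabla^L_YJ)JX-(\nabla^L_{JY}J)X]$. Curvature: $R^k(X,Y)Z=\nabla^k_X\nabla^k_YZ-\nabla^k_Y\nabla^k_XZ-\nabla^k_{[X,Y]}Z$.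 Ricci tensor: $\rho^k(X,Y)=-g(R^k(X,\widetilde e_1)Y,\widetilde e_1)-g(R^k(X,\widetilde e_2)Y,\widetilde e_2)+g(R^k(X,\widetilde e_3)Y,\widetilde e_3)$. Symmetrized Ricci tensor: $\widetilde\rho^k(X,Y)=\tfrac12(\rho^k(X,Y)+\rho^k(Y,X))$. For a linear connection $\nabla$ and a $(0,2)$ tensor field $\omega$: $(\nabla_X\omega)(Y,Z)=X[\omega(Y,Z)]-\omega(\nabla_XY,Z)-\omega(Y,\nabla_XZ)$. The tensor $\omega$ is called a Codazzi tensor on $(G,\nabla)$ if $(\nabla_X\omega)(Y,Z)-(\nabla_Y\omega)(X,Z)=0$ for all vector fields $X,Y,Z$. *)

(* Defs.v *)
From HB Require Import structures.
From mathcomp Require Import all_boot all_order all_algebra.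
From mathcomp Require Import all_classical all_reals all_analysis.
Import Order.TTheory GRing.Theory Num.Theory.
Import numFieldNormedType.Exports.

Set Implicit Arguments.
Unset Strict Implicit.
Unset Printing Implicit Defensive.

Local Open Scope classical_set_scope.
Local Open Scope ring_scope.

HB.mixin Record Topological_isTopologicalGroup G & Topological G & Group G := {
  mulg_continuous : continuous (fun x : G * G => (x.1 * x.2)%g : G);
  invg_continuous : continuous (fun x : G => (x^-1)%g : G)
}.

#[short(type="topologicalGroupType")]
HB.structure Definition TopologicalGroup :=
  {G of Topological G & Group G & Topological_isTopologicalGroup G}.

(* In dimension > 1 existence of partial derivatives is too weak, so total
   differentiability is required at each order; [cdiff k U f] is then
   "f is of class C^k on the open set U". *)
Fixpoint cdiff {R : realType} {n : nat} (k : nat) (U : set 'rV[R]_n)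
    (f : 'rV[R]_n -> R) : Prop :=
  if k is k'.+1 then
    (forall x, U x -> differentiable f x) /\
    (forall i : 'I_n, cdiff k' U (fun x => 'D_(delta_mx 0 i) f x))
  else forall x, U x -> {for x, continuous f}.

Definition smooth_on {R : realType} {n : nat} (U : set 'rV[R]_n)
  (f : 'rV[R]_n -> R) : Prop := forall k, cdiff k U f.

(* The values of [cmap] outside [cdom] and of [cinv] outside [cimg] are
   irrelevant. *)
Record chart (R : realType) (n : nat) (M : Type) := Chart {
  cdom : set M;
  cimg : set 'rV[R]_n;
  cmap : M -> 'rV[R]_n;
  cinv : 'rV[R]_n -> M
}.

Section Manifold.
Context {R : realType} {n : nat} {M : topologicalType}.
Local Notation functional := ((M -> R) -> R).
Local Notation operator := ((M -> R) -> (M -> R)).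

Definition is_chart (c : chart R n M) : Prop :=
  [/\ open (cdom c) /\ open (cimg c),
      forall p, cdom c p -> cimg c (cmap c p) /\ cinv c (cmap c p) = p,
      forall x, cimg c x -> cdom c (cinv c x) /\ cmap c (cinv c x) = x,
      forall p, cdom c p -> {for p, continuous (cmap c)} &
      forall x, cimg c x -> {for x, continuous (cinv c)}].

Definition is_smooth_manifold (A : set (chart R n M)) : Prop :=
  [/\ hausdorff_space M /\ @second_countable M,
      forall c, A c -> is_chart c,
      forall p, exists2 c, A c & cdom c p &
      forall c d (i : 'I_n), A c -> A d ->
        smooth_on [set x | cimg c x /\ cdom d (cinv c x)]
          (fun x => cmap d (cinv c x) 0 i)].

Definition smooth (A : set (chart R n M)) (f : M -> R) : Prop :=
  forall c, A c -> smooth_on (cimg c) (fun x => f (cinv c x)).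

(* Tangent vectors at p are the derivations at p of the algebra of smooth
   functions.  They are represented by functionals on all functions; the value
   0 on non-smooth functions makes Leibniz equality the right one. *)
Definition tangent (A : set (chart R n M)) (p : M) (v : functional) : Prop :=
  [/\ forall (a : R) f h, smooth A f -> smooth A h ->
        v (a *: f + h) = a * v f + v h,
      forall f h, smooth A f -> smooth A h ->
        v (f * h) = f p * v h + h p * v f &
      forall f, ~ smooth A f -> v f = 0].

(* A vector field X acts on functions by (X f)(p) = X_p f. *)
Definition value_at (X : operator) (p : M) : functional :=
  fun f => X f p.

Definition vfield (A : set (chart R n M)) (X : operator) : Prop :=
  (forall p, tangent A p (value_at X p)) /\
  (forall f, smooth A f -> smooth A (X f)).

Definition fscale (f : M -> R) (X : operator) :
  operator := fun h => f * X h.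

Definition lie_bracket (X Y : operator) : operator :=
  fun h => X (Y h) - Y (X h).

Definition tangent_basis (A : set (chart R n M)) (p : M)
    (b1 b2 b3 : functional) : Prop :=
  [/\ tangent A p b1, tangent A p b2, tangent A p b3 &
      forall v, tangent A p v ->
        exists! c : R * R * R, v = c.1.1 *: b1 + c.1.2 *: b2 + c.2 *: b3].

Definition metric_on (g : M -> functional -> functional -> R)
    (X Y : operator) : M -> R :=
  fun p => g p (value_at X p) (value_at Y p).

(* Smooth symmetric (0,2) tensor field of signature (+,+,-) on a 3-manifold;
   nondegeneracy is implied by the pseudo-orthonormal bases. *)
Definition lorentz_metric3 (A : set (chart R n M))
    (g : M -> functional -> functional -> R) : Prop :=
  [/\ forall p (a : R) u v w, tangent A p u -> tangent A p v ->
        tangent A p w -> g p (a *: u + v) w = a * g p u w + g p v w,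
      forall p v w, tangent A p v -> tangent A p w -> g p v w = g p w v,
      forall p, exists b1 b2 b3, tangent_basis A p b1 b2 b3 /\
        [/\ g p b1 b1 = 1, g p b2 b2 = 1, g p b3 b3 = -1 &
            [/\ g p b1 b2 = 0, g p b1 b3 = 0 & g p b2 b3 = 0]] &
      forall X Y, vfield A X -> vfield A Y -> smooth A (metric_on g X Y)].

Definition apply_tensor11 (J : M -> functional -> functional)
    (X : operator) : operator :=
  fun f p => J p (value_at X p) f.

Definition tensor11 (A : set (chart R n M))
    (J : M -> functional -> functional) : Prop :=
  [/\ forall p v, tangent A p v -> tangent A p (J p v),
      forall p (a : R) v w, tangent A p v -> tangent A p w ->
        J p (a *: v + w) = a *: J p v + J p w &
      forall X, vfield A X -> vfield A (apply_tensor11 J X)].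

Definition tensor02 (A : set (chart R n M))
    (w : operator -> operator -> M -> R) : Prop :=
  [/\ forall X Y, vfield A X -> vfield A Y -> smooth A (w X Y),
      forall f X Y Z, smooth A f -> vfield A X -> vfield A Y -> vfield A Z ->
        w (fscale f X + Y) Z = f * w X Z + w Y Z &
      forall f X Y Z, smooth A f -> vfield A X -> vfield A Y -> vfield A Z ->
        w X (fscale f Y + Z) = f * w X Y + w X Z].

(* [D X Y] is the covariant derivative of Y along X. *)
Definition connection (A : set (chart R n M))
    (D : operator -> operator -> operator) : Prop :=
  [/\ forall X Y, vfield A X -> vfield A Y -> vfield A (D X Y),
      forall f X Y Z, smooth A f -> vfield A X -> vfield A Y -> vfield A Z ->
        D (fscale f X + Y) Z = fscale f (D X Z) + D Y Z,
      forall X Y Z, vfield A X -> vfield A Y -> vfield A Z ->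
        D X (Y + Z) = D X Y + D X Z &
      forall f X Y, smooth A f -> vfield A X -> vfield A Y ->
        D X (fscale f Y) = fscale (X f) Y + fscale f (D X Y)].

Definition levi_civita (A : set (chart R n M))
    (g : M -> functional -> functional -> R)
    (D : operator -> operator -> operator) : Prop :=
  [/\ connection A D,
      forall X Y, vfield A X -> vfield A Y ->
        D X Y - D Y X = lie_bracket X Y &
      forall X Y Z, vfield A X -> vfield A Y -> vfield A Z ->
        X (metric_on g Y Z) = metric_on g (D X Y) Z + metric_on g Y (D X Z)].

(* In the next definitions, [D] is a connection and [J] acts on vector
   fields. *)
Definition nabla_tensor11
    (D : operator -> operator -> operator)
    (J : operator -> operator)
    (X Y : operator) : operator :=
  D X (J Y) - J (D X Y).

Definition canonical_connection
    (D : operator -> operator -> operator)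
    (J : operator -> operator)
    (X Y : operator) : operator :=
  D X Y - 2^-1 *: nabla_tensor11 D J X (J Y).

Definition kobayashi_nomizu
    (D : operator -> operator -> operator)
    (J : operator -> operator)
    (X Y : operator) : operator :=
  canonical_connection D J X Y
  - 4^-1 *: (nabla_tensor11 D J Y (J X) - nabla_tensor11 D J (J Y) X).

Definition curvature
    (D : operator -> operator -> operator)
    (X Y Z : operator) : operator :=
  D X (D Y Z) - D Y (D X Z) - D (lie_bracket X Y) Z.

(* [e3] is the timelike member of the pseudo-orthonormal frame. *)
Definition ricci (g : M -> functional -> functional -> R)
    (e1 e2 e3 : operator)
    (D : operator -> operator -> operator)
    (X Y : operator) : M -> R :=
  - metric_on g (curvature D X e1 Y) e1
  - metric_on g (curvature D X e2 Y) e2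
  + metric_on g (curvature D X e3 Y) e3.

Definition symmetrized_ricci
    (g : M -> functional -> functional -> R)
    (e1 e2 e3 : operator)
    (D : operator -> operator -> operator)
    (X Y : operator) : M -> R :=
  2^-1 *: (ricci g e1 e2 e3 D X Y + ricci g e1 e2 e3 D Y X).

Definition nabla_tensor02
    (D : operator -> operator -> operator)
    (w : operator -> operator -> M -> R)
    (X Y Z : operator) : M -> R :=
  X (w Y Z) - w (D X Y) Z - w Y (D X Z).

Definition codazzi_tensor (A : set (chart R n M))
    (D : operator -> operator -> operator)
    (w : operator -> operator -> M -> R) : Prop :=
  tensor02 A w /\
  forall X Y Z, vfield A X -> vfield A Y -> vfield A Z ->
    nabla_tensor02 D w X Y Z - nabla_tensor02 D w Y X Z = 0.

Definition simply_connected : Prop :=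
  (forall p q : M, exists c : R -> M,
    [/\ {within `[0, 1], continuous c}, c 0 = p & c 1 = q]) /\
  (forall c : R -> M, {within `[0, 1], continuous c} -> c 0 = c 1 ->
    exists2 H : R * R -> M, {within `[0, 1] `*` `[0, 1], continuous H} &
      forall t, t \in `[0, 1] ->
        [/\ H (0, t) = c t, H (1, t) = c 0, H (t, 0) = c 0 & H (t, 1) = c 0]).

End Manifold.

Section LieGroup.
Context {R : realType} {n : nat} {G : topologicalGroupType}.
Local Notation functional := ((G -> R) -> R).
Local Notation operator := ((G -> R) -> (G -> R)).

Definition is_lie_group (A : set (chart R n G)) : Prop :=
  [/\ is_smooth_manifold A,
      forall c d e (i : 'I_n), A c -> A d -> A e ->
        smooth_on
          [set z : 'rV[R]_(n + n) |
            [/\ cimg c (lsubmx z), cimg d (rsubmx z) &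
                cdom e (cinv c (lsubmx z) * cinv d (rsubmx z))%g]]
          (fun z => cmap e (cinv c (lsubmx z) * cinv d (rsubmx z))%g 0 i) &
      forall c d (i : 'I_n), A c -> A d ->
        smooth_on [set x | cimg c x /\ cdom d (cinv c x)^-1%g]
          (fun x => cmap d (cinv c x)^-1%g 0 i)].

Definition ltrans (a : G) : G -> G := fun x => (a * x)%g.

Definition left_invariant_vfield (A : set (chart R n G))
    (X : operator) : Prop :=
  vfield A X /\
  forall a f, smooth A f -> X (f \o ltrans a) = X f \o ltrans a.

Definition pushforward_ltrans (a : G) (v : functional) : functional :=
  fun f => v (f \o ltrans a).

Definition left_invariant_metric (A : set (chart R n G))
    (g : G -> functional -> functional -> R) : Prop :=
  forall a p v w, tangent A p v -> tangent A p w ->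
    g (a * p)%g (pushforward_ltrans a v) (pushforward_ltrans a w) = g p v w.

(* The Lie algebra of G is its tangent space at 1; a basis of it is given by
   the left-invariant vector fields extending the basis vectors. *)
Definition lie_algebra_basis (A : set (chart R n G))
    (e1 e2 e3 : operator) : Prop :=
  [/\ left_invariant_vfield A e1, left_invariant_vfield A e2,
      left_invariant_vfield A e3 &
      tangent_basis A 1%g (value_at e1 1%g) (value_at e2 1%g)
        (value_at e3 1%g)].

End LieGroup.

Arguments simply_connected : clear implicits.

(* Main.v *)
Require Import Defs.
From mathcomp Require Import all_boot all_order all_algebra.
From mathcomp Require Import ring.
From mathcomp Require Import all_classical all_reals all_analysis.
Import Order.TTheory GRing.Theory Num.Theory.
Import numFieldNormedType.Exports.

Local Open Scope classical_set_scope.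
Local Open Scope ring_scope.

(** Why the symmetrized Ricci tensor is Codazzi: it is parallel.

    Let theta_1, theta_2, theta_3 be the coframe dual to the frame
    e_1, e_2, e_3.  The eigenspaces of J are spanned by e_1, e_2 (eigenvalue 1)
    and by e_3 (eigenvalue -1).  For X and Y in opposite eigenspaces, torsion
    freeness of nabla^L turns nabla^k_X Y into the projection of [X, Y] on the
    eigenspace of Y ([kobayashi_nomizu_opposite]); for X and Y in the same one,
    nabla^k_X Y is the projection of nabla^L_X Y ([kobayashi_nomizu_same]).
    Within the plane e_1, e_2 this projection vanishes because [e_1, e_2] is a
    multiple of e_3 ([levi_civita_plane]).  Hence the only nonzero derivatives
    of the frame are
      nabla^k_{e_3} e_1 = beta e_2,   nabla^k_{e_3} e_2 = - alpha e_1
    ([kobayashi_nomizu_frame]).  In other words the connection form is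
    theta_3 (x) S, where S e_1 = beta e_2, S e_2 = - alpha e_1, S e_3 = 0.

    A connection form of that shape commutes with itself, so the curvature is
    R(X, Y) = d theta_3(X, Y) S ([curvature_coords]).  The brackets give
    d theta_3 = gamma theta_1 /\ theta_2 ([d_coframe3]), and taking the trace
    yields
      rho = - gamma (beta theta_1^2 + alpha theta_2^2)
    ([ricci_diagonal]), which is already symmetric.  Since S is skew for the
    quadratic form beta theta_1^2 + alpha theta_2^2, this tensor is parallel
    ([diagonal_form_parallel]), and a parallel tensor is Codazzi
    ([parallel_codazzi]).

    All of this is a computation in coordinates with respect to the frame, and
    it applies to arbitrary vector fields because the e_i form a basis at every
    point: they are pseudo-orthonormal and as numerous as the given
    pseudo-orthonormal basis ([pseudo_orthonormal_expansion]).  The coordinates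
    are smooth since they are values of the metric. *)

Set Implicit Arguments.
Unset Strict Implicit.
Unset Printing Implicit Defensive.

(** * The ring of smooth functions *)

Lemma near_eq_differentiable (R : realType) (V W : normedModType R)
    (f h : V -> W) (x : V) :
  {near x, f =1 h} -> differentiable f x -> differentiable h x.
Proof.
move=> fh /diff_locallyP[dfc dfx].
have hx : h \o shift x = cst (h x) + 'd f x +o_ 0 id.
  apply/eqaddoP => e e0.
  move: dfx => /eqaddoP/(_ e e0) fe.
  near=> y.
  have -> : (h \o shift x - (cst (h x) + 'd f x)) y =
            (f \o shift x - (cst (f x) + 'd f x)) y.
    rewrite !fctE /= (nbhs_singleton fh); congr (_ - _); apply/esym.
    by near: y; move: fh; rewrite (near_shift 0) /= subr0.
  by near: y.
by apply/diff_locallyP; rewrite (diff_unique dfc hx).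
Unshelve. all: by end_near. Qed.

Section Smoothness.
Context {R : realType} {n : nat}.
Implicit Types (U : set 'rV[R]_n) (f h : 'rV[R]_n -> R).

Lemma eq_on_near {T : topologicalType} {S : Type} (U : set T) (f h : T -> S) x :
  open U -> (forall y, U y -> f y = h y) -> U x -> {near x, f =1 h}.
Proof. by move=> oU fh Ux; near do apply: fh; exact: open_nbhs_nbhs.
Unshelve. all: by end_near. Qed.

(** Derivatives of a sum or a product are given by the usual rules only on the
    set where the factors are differentiable, hence the need to know that
    [cdiff] ignores values outside an open set. *)
Lemma eq_cdiff k U f h : open U -> (forall x, U x -> f x = h x) ->
  cdiff k U f -> cdiff k U h.
Proof.
move=> oU; elim: k f h => [|k IH] f h fh /=.
  move=> cf x Ux; rewrite /prop_for /continuous_at -(fh _ Ux).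
  exact: cvg_trans (near_eq_cvg (eq_on_near oU fh Ux)) (cf x Ux).
move=> [df ddf]; split=> [x Ux|i].
  exact: near_eq_differentiable (eq_on_near oU fh Ux) (df x Ux).
apply: IH (ddf i) => x Ux; apply: near_eq_derive.
exact: eq_on_near fh Ux.
Qed.

Lemma cdiffS k U f : cdiff k.+1 U f -> cdiff k U f.
Proof.
elim: k f => [|k IH] f [df ddf];
  first by move=> x /df/differentiable_continuous.
by split=> // i; exact: IH (ddf i).
Qed.

Lemma cdiff_cst k U (a : R) : cdiff k U (cst a).
Proof.
elim: k a => [|k IH] a; first by move=> x _; exact: cst_continuous.
split=> [x _|i]; first exact: differentiable_cst.
have -> : 'D_(delta_mx 0 i) (cst a : 'rV[R]_n -> R) = cst (0 : R).
  by apply/funext => x; rewrite derive_cst.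
exact: IH.
Qed.

Lemma cdiffD k U f h : open U ->
  cdiff k U f -> cdiff k U h -> cdiff k U (f + h).
Proof.
move=> oU; elim: k f h => [|k IH] f h /=.
  by move=> cf ch x Ux; exact: continuousD (cf x Ux) (ch x Ux).
move=> [df ddf] [dh ddh]; split=> [x Ux|i].
  by apply: differentiableD; [exact: df|exact: dh].
apply: eq_cdiff (IH _ _ (ddf i) (ddh i)) => // x Ux.
by rewrite deriveD //; apply: diff_derivable; [exact: df|exact: dh].
Qed.

Lemma cdiffM k U f h : open U ->
  cdiff k U f -> cdiff k U h -> cdiff k U (f * h).
Proof.
move=> oU; elim: k f h => [|k IH] f h.
  by move=> cf ch x Ux; exact: continuousM (cf x Ux) (ch x Ux).
move=> Cf Ch; have := cdiffS Cf; have := cdiffS Ch.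
move: Cf Ch => [df ddf] [dh ddh] cf ch; split=> [x Ux|i].
  by apply: differentiableM; [exact: df|exact: dh].
apply: (eq_cdiff oU _ (cdiffD oU
  (IH _ _ ch (ddh i)) (IH _ _ cf (ddf i)))) => // x Ux.
by rewrite deriveM //; apply: diff_derivable; [exact: df|exact: dh].
Qed.
End Smoothness.

(** * Vector fields as a module over the smooth functions *)

Section VectorFields.
Context {R : realType} {n : nat} {M : topologicalType} {A : set (chart R n M)}.
(* Without open chart images, the rules for derivatives of sums and products
   could not be iterated. *)
Hypothesis oA : forall c, A c -> open (cimg c).
Local Notation functional := ((M -> R) -> R).
Local Notation operator := ((M -> R) -> (M -> R)).
Implicit Types (f h : M -> R) (X Y Z : operator) (a : R).

Lemma smooth_cst a : smooth A (cst a).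
Proof. by move=> c Ac k; exact: cdiff_cst. Qed.

Lemma smoothD f h : smooth A f -> smooth A h -> smooth A (f + h).
Proof.
by move=> sf sh c Ac k; apply: cdiffD; [exact: oA|exact: sf|exact: sh].
Qed.

Lemma smoothM f h : smooth A f -> smooth A h -> smooth A (f * h).
Proof.
by move=> sf sh c Ac k; apply: cdiffM; [exact: oA|exact: sf|exact: sh].
Qed.

Lemma smoothZ a f : smooth A f -> smooth A (a *: f).
Proof. exact/smoothM/smooth_cst. Qed.

Lemma smoothN f : smooth A f -> smooth A (- f).
Proof. by rewrite -scaleN1r; exact: smoothZ. Qed.

Lemma smoothB f h : smooth A f -> smooth A h -> smooth A (f - h).
Proof. by move=> sf sh; apply: smoothD => //; exact: smoothN. Qed.

Lemma vfield_lin X a f h : vfield A X -> smooth A f -> smooth A h ->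
  X (a *: f + h) = a *: X f + X h.
Proof.
by move=> [tX _] sf sh; apply/funext => p; have [Xl _ _] := tX p;
  exact: Xl.
Qed.

Lemma vfield_nonsmooth X f : vfield A X -> ~ smooth A f -> X f = cst 0.
Proof.
by move=> [tX _] nf; apply/funext => p; have [_ _ X0] := tX p;
  exact: X0.
Qed.

Lemma vfield_leibniz X f h : vfield A X -> smooth A f -> smooth A h ->
  X (f * h) = f * X h + h * X f.
Proof.
by move=> [tX _] sf sh; apply/funext => p; have [_ XM _] := tX p;
  exact: XM.
Qed.

(** On a function that is not smooth the value is zero by convention, which is
    smooth. *)
Lemma vfield_smooth X f : vfield A X -> smooth A (X f).
Proof.
move=> vX; have [|nf] := pselect (smooth A f); first exact: vX.2.
by rewrite vfield_nonsmooth //; exact: smooth_cst.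
Qed.

Lemma vfield_add X f h : vfield A X -> smooth A f -> smooth A h ->
  X (f + h) = X f + X h.
Proof. by move=> vX sf sh; rewrite -[f]scale1r vfield_lin // !scale1r. Qed.

Lemma vfield_cst X a : vfield A X -> X (cst a) = cst 0.
Proof.
move=> vX; have X1 : X (cst 1) = 0.
  have /eqP := vfield_leibniz vX (smooth_cst 1) (smooth_cst 1).
  rewrite -[cst 1]/(1 : M -> R) !mul1r -subr_eq0 opprD addrA subrr sub0r.
  by rewrite oppr_eq0 => /eqP.
have X0 : X (cst 0) = 0.
  apply: (@addrI _ (X (cst 0))).
  by rewrite -vfield_add; [rewrite ![cst 0 + _]addr0 addr0|..];
     do ?exact: smooth_cst.
have -> : cst a = a *: cst 1 + cst 0 :> (M -> R).
  by apply/funext => p; rewrite /cst/= addr0; apply/esym/mulr1.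
by rewrite vfield_lin ?X1 ?X0 ?scaler0 ?addr0 //; exact: smooth_cst.
Qed.

Lemma vfield_scale X a f : vfield A X -> smooth A f -> X (a *: f) = a *: X f.
Proof.
move=> vX sf; rewrite -[a *: f]addr0 vfield_lin //; last exact: smooth_cst.
by rewrite -[0 : M -> R]/(cst 0) vfield_cst // addr0.
Qed.

(** The defining conditions of a vector field, free of base points. *)
Lemma vfieldP X :
  (forall a f h, smooth A f -> smooth A h -> X (a *: f + h) = a *: X f + X h) ->
  (forall f h, smooth A f -> smooth A h -> X (f * h) = f * X h + h * X f) ->
  (forall f, ~ smooth A f -> X f = cst 0) ->
  (forall f, smooth A f -> smooth A (X f)) -> vfield A X.
Proof.
move=> Xl XM X0 sX; split=> [p|//]; split=> [a f h sf sh|f h sf sh|f nf].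
- by rewrite /value_at Xl.
- by rewrite /value_at XM.
- by rewrite /value_at X0.
Qed.

Lemma vfield_fscaleD f X Y : smooth A f -> vfield A X -> vfield A Y ->
  vfield A (fscale f X + Y).
Proof.
move=> sf vX vY; apply: vfieldP => [a u v su sv|u v su sv|u nu|u su];
  rewrite /fscale !fctE.
- rewrite (vfield_lin _ vX su sv) (vfield_lin _ vY su sv);
  apply/funext => p; rewrite !fctE /GRing.scale/=; ring.
- rewrite (vfield_leibniz vX su sv) (vfield_leibniz vY su sv);
  apply/funext => p; rewrite !fctE; ring.
- by rewrite (vfield_nonsmooth vX nu) (vfield_nonsmooth vY nu);
  apply/funext => p; rewrite !fctE mulr0 addr0.
- by apply: smoothD; [apply: smoothM|] => //; exact: vfield_smooth.
Qed.

Lemma vfield0 : vfield A (0 : operator).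
Proof.
have E u : (0 : operator) u = 0 by [].
apply: vfieldP => [a u v su sv|u v su sv|u nu|u su]; rewrite !E.
- by rewrite scaler0 addr0.
- by rewrite !mulr0 addr0.
- by [].
- exact: smooth_cst.
Qed.

Lemma fscale1 X : fscale (cst 1) X = X.
Proof.
by apply/funext => h; apply/funext => p;
  rewrite /fscale !fctE mul1r.
Qed.

Lemma vfieldD X Y : vfield A X -> vfield A Y -> vfield A (X + Y).
Proof. by rewrite -[X in X + _]fscale1; apply/vfield_fscaleD/smooth_cst. Qed.

Lemma vfield_fscale f X : smooth A f -> vfield A X -> vfield A (fscale f X).
Proof.
by move=> sf vX; rewrite -[fscale _ _]addr0;
  exact: (vfield_fscaleD _ _ vfield0).
Qed.

Lemma vfieldZ a X : vfield A X -> vfield A (a *: X).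
Proof. exact: (vfield_fscale (smooth_cst a)). Qed.

Lemma vfieldN X : vfield A X -> vfield A (- X).
Proof. by rewrite -scaleN1r; exact: vfieldZ. Qed.

Lemma vfieldB X Y : vfield A X -> vfield A Y -> vfield A (X - Y).
Proof. by move=> vX vY; apply: vfieldD => //; exact: vfieldN. Qed.

Lemma vfield_bracket X Y : vfield A X -> vfield A Y ->
  vfield A (lie_bracket X Y).
Proof.
move=> vX vY; have sX u := vfield_smooth u vX; have sY u := vfield_smooth u vY.
apply: vfieldP => [a u v su sv|u v su sv|u nu|u su]; rewrite /lie_bracket.
- rewrite (vfield_lin _ vX su sv) (vfield_lin _ vY su sv).
  rewrite (vfield_lin _ vX (sY u) (sY v)) (vfield_lin _ vY (sX u) (sX v)).
  by rewrite scalerBr; apply/funext => p; rewrite !fctE; ring.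
- rewrite (vfield_leibniz vX su sv) (vfield_leibniz vY su sv).
  rewrite (vfield_add vX (smoothM su (sY v)) (smoothM sv (sY u))).
  rewrite (vfield_add vY (smoothM su (sX v)) (smoothM sv (sX u))).
  rewrite (vfield_leibniz vX su (sY v)) (vfield_leibniz vX sv (sY u)).
  rewrite (vfield_leibniz vY su (sX v)) (vfield_leibniz vY sv (sX u)).
  by apply/funext => p; rewrite !fctE; ring.
- rewrite (vfield_nonsmooth vX nu) (vfield_nonsmooth vY nu).
  by rewrite (vfield_cst _ vX) (vfield_cst _ vY) subrr.
- by apply: smoothB.
Qed.

Lemma lie_bracketC X Y : lie_bracket X Y = - lie_bracket Y X.
Proof. by apply/funext => h; apply/esym/opprB. Qed.

(** The last term is the defect of tensoriality of the bracket; it is what the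
    exterior derivative of a one-form compensates. *)
Lemma lie_bracket_fscaleD f X Y Z : smooth A f ->
  vfield A X -> vfield A Y -> vfield A Z ->
  lie_bracket (fscale f X + Y) Z =
  fscale f (lie_bracket X Z) + lie_bracket Y Z - fscale (Z f) X.
Proof.
move=> sf vX vY vZ; apply/funext => h; rewrite /lie_bracket /fscale !fctE.
have sX u := vfield_smooth u vX; have sY u := vfield_smooth u vY.
rewrite (vfield_add vZ (smoothM sf (sX h)) (sY h)).
rewrite (vfield_leibniz vZ sf (sX h)).
by apply/funext => p; rewrite !fctE; ring.
Qed.
End VectorFields.

(** * Pseudo-orthonormal families *)

Lemma linear_on_sum (R : comNzRingType) (V W : lmodType R) (T : set V)
    (F : V -> W) (I : finType) (c : I -> R) (b : I -> V) :
  T 0 -> (forall a u v, T u -> T v -> T (a *: u + v)) ->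
  (forall a u v, T u -> T v -> F (a *: u + v) = a *: F u + F v) ->
  (forall i, T (b i)) ->
  F (\sum_i c i *: b i) = \sum_i c i *: F (b i).
Proof.
move=> T0 TD FD Tb.
have F0 : F 0 = 0.
  by apply: (@addrI _ (F 0)); rewrite -{1}[F 0]scale1r -FD // scale1r !addr0.
suff [] : T (\sum_i c i *: b i) /\ F (\sum_i c i *: b i) =
  \sum_i c i *: F (b i) by [].
elim/big_rec2: _ => // i w v _ [Tv <-]; split; first exact: TD.
by rewrite FD.
Qed.

(** A pseudo-orthonormal family as large as a pseudo-orthonormal basis is itself
    a basis.  If [U] is the matrix of the family in the basis and [S] the Gram
    matrix, the hypothesis says U S U^T = S, so that S U^T S is a right inverse
    of [U].  For a square matrix it is also a left inverse, as claimed. *)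
Lemma pseudo_orthonormal_expansion (R : comUnitRingType) (V : lmodType R)
    (T : set V) (g : V -> V -> R) (n : nat) (s : 'I_n -> R) (b u : 'I_n -> V) :
  T 0 -> (forall a v w, T v -> T w -> T (a *: v + w)) ->
  (forall a v w z, T v -> T w -> T z -> g (a *: v + w) z = a * g v z + g w z) ->
  (forall v w, T v -> T w -> g v w = g w v) ->
  (forall i, T (b i)) -> (forall i, T (u i)) ->
  (forall v, T v -> exists c : 'I_n -> R, v = \sum_i c i *: b i) ->
  (forall i, s i * s i = 1) ->
  (forall i j, g (b i) (b j) = s i *+ (i == j)) ->
  (forall i j, g (u i) (u j) = s i *+ (i == j)) ->
  forall v, T v -> v = \sum_i (s i * g v (u i)) *: u i.
Proof.
move=> T0 TD gD gC Tb Tu spanb ss gb gu v Tv.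
have Tsum (c : 'I_n -> R) : T (\sum_i c i *: b i).
  by elim/big_ind: _ => // [x y Tx Ty|i _];
    [rewrite -[x]scale1r; exact: TD|rewrite -[_ *: _]addr0; exact: TD].
have gsum (c d : 'I_n -> R) :
    g (\sum_i c i *: b i) (\sum_i d i *: b i) = \sum_i c i * s i * d i.
  rewrite (@linear_on_sum R V R^o T (g ^~ _)) //; last by move=> *; exact: gD.
  apply: eq_bigr => i _; rewrite gC //.
  rewrite (@linear_on_sum R V R^o T (g ^~ _)) //; last by move=> *; exact: gD.
  rewrite (bigD1 i) //= big1 => [|j /negPf ji].
    by rewrite gb eqxx addr0 /GRing.scale/= mulrA mulrAC.
  by rewrite gb ji mulr0n scaler0.
have [c vE] := spanb _ Tv.
have /choice[P uE] i := spanb _ (Tu i).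
pose U := \matrix_(i, j) P i j; pose S := diag_mx (\row_i s i).
have SS : S *m S = 1%:M.
  apply/matrixP => i j; rewrite mul_diag_mx !mxE mulrnAr ss.
  by [].
have USU : U *m (S *m U^T *m S) = 1%:M.
  rewrite !mulmxA -SS; congr (_ *m _); apply/matrixP => i j.
  rewrite [LHS]mxE [RHS]mxE [X in _ = X *+ _]mxE -gu (uE i) (uE j) gsum.
  by apply: eq_bigr => k _; rewrite mul_mx_diag !mxE.
have {USU} USU := mulmx1C USU.
rewrite [LHS]vE; under [RHS]eq_bigr => i _ do
  rewrite [X in g X _]vE [X in g _ X]uE gsum [X in _ *: X]uE scaler_sumr.
rewrite exchange_big /=; apply: eq_bigr => j _.
under eq_bigr => i _ do rewrite scalerA; rewrite -scaler_suml; congr (_ *: _).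
under eq_bigr => i _ do rewrite mulr_sumr mulr_suml.
rewrite exchange_big /= (bigD1 j) //= [X in _ + X]big1 ?addr0 => [|k kj].
  transitivity (c j * (S *m U^T *m S *m U) j j).
    by rewrite USU mxE eqxx mulr1.
  rewrite mxE mulr_sumr; apply: eq_bigr => i _.
  by rewrite mul_mx_diag mul_diag_mx !mxE; ring.
transitivity (c k * (S *m U^T *m S *m U) k j); last first.
  by rewrite USU mxE (negPf kj) mulr0.
rewrite mxE mulr_sumr; apply: eq_bigr => i _.
by rewrite mul_mx_diag mul_diag_mx !mxE; ring.
Qed.

(** * Tensors and connections *)

Section TensorDefinitions.
Context {R : realType} {n : nat} {M : topologicalType} (A : set (chart R n M)).
Local Notation operator := ((M -> R) -> (M -> R)).
Implicit Types (f : M -> R) (X Y : operator).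

(** Maps between vector fields are encoded together with their linearity over
    the smooth functions, which is what makes them tensors. *)
Definition one_form (t : operator -> M -> R) : Prop :=
  (forall X, vfield A X -> smooth A (t X)) /\
  (forall f X Y, smooth A f -> vfield A X -> vfield A Y ->
     t (fscale f X + Y) = f * t X + t Y).

Definition endomorphism (T : operator -> operator) : Prop :=
  (forall X, vfield A X -> vfield A (T X)) /\
  (forall f X Y, smooth A f -> vfield A X -> vfield A Y ->
     T (fscale f X + Y) = fscale f (T X) + T Y).

Definition bilinear_map (S : operator -> operator -> operator) : Prop :=
  (forall Y, vfield A Y -> endomorphism (S ^~ Y)) /\
  (forall X, vfield A X -> endomorphism (S X)).

End TensorDefinitions.

Section Tensors.
Context {R : realType} {n : nat} {M : topologicalType} {A : set (chart R n M)}.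
Hypothesis oA : forall c, A c -> open (cimg c).
Local Notation operator := ((M -> R) -> (M -> R)).
Implicit Types (f h : M -> R) (X Y Z : operator) (a : R).

Section OneForm.
Variable t : operator -> M -> R.
Hypothesis tA : one_form A t.

Lemma one_formD X Y : vfield A X -> vfield A Y -> t (X + Y) = t X + t Y.
Proof.
move=> vX vY; rewrite -{1}[X]fscale1 tA.2 ?[cst 1 * _]mul1r //.
exact: smooth_cst.
Qed.

Lemma one_form0 : t 0 = 0.
Proof.
apply: (@addrI _ (t 0)); rewrite -one_formD ?addr0 //; exact: vfield0.
Qed.

Lemma one_form_fscale f X : smooth A f -> vfield A X ->
  t (fscale f X) = f * t X.
Proof.
move=> sf vX; rewrite -[fscale _ _]addr0 tA.2 ?one_form0 ?addr0 //.
exact: vfield0.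
Qed.

Lemma one_formZ a X : vfield A X -> t (a *: X) = a *: t X.
Proof. by move=> vX; exact: (one_form_fscale (smooth_cst a) vX). Qed.

Lemma one_formN X : vfield A X -> t (- X) = - t X.
Proof. by move=> vX; rewrite -scaleN1r one_formZ // scaleN1r. Qed.

Lemma one_formB X Y : vfield A X -> vfield A Y -> t (X - Y) = t X - t Y.
Proof. by move=> vX vY; rewrite one_formD ?one_formN //; exact: vfieldN. Qed.
End OneForm.

Section Endomorphism.
Variable T : operator -> operator.
Hypothesis TA : endomorphism A T.

Lemma endoD X Y : vfield A X -> vfield A Y -> T (X + Y) = T X + T Y.
Proof.
move=> vX vY; rewrite -{1}[X]fscale1 TA.2 ?fscale1 //; exact: smooth_cst.
Qed.

Lemma endo0 : T 0 = 0.
Proof.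
apply: (@addrI _ (T 0)); rewrite -endoD ?addr0 //; exact: vfield0.
Qed.

Lemma endo_fscale f X : smooth A f -> vfield A X ->
  T (fscale f X) = fscale f (T X).
Proof.
by move=> sf vX; rewrite -[fscale _ _]addr0 TA.2 ?endo0 ?addr0 //;
  exact: vfield0.
Qed.

Lemma endoZ a X : vfield A X -> T (a *: X) = a *: T X.
Proof. by move=> vX; exact: (endo_fscale (smooth_cst a) vX). Qed.

Lemma endoB X Y : vfield A X -> vfield A Y -> T (X - Y) = T X - T Y.
Proof.
move=> vX vY; rewrite endoD //; last exact: vfieldN.
by rewrite -[- Y]scaleN1r endoZ // scaleN1r.
Qed.
End Endomorphism.

Lemma bilinearZ a S : bilinear_map A S ->
  bilinear_map A (fun X Y => a *: S X Y).
Proof.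
move=> [Sl Sr]; split=> Z vZ; split=> [X vX|f X Y sf vX vY].
- exact/vfieldZ/(Sl _ vZ).1.
- rewrite (Sl _ vZ).2 //; apply/funext => h; apply/funext => p.
  by rewrite /fscale !fctE /GRing.scale/=; ring.
- exact/vfieldZ/(Sr _ vZ).1.
- rewrite (Sr _ vZ).2 //; apply/funext => h; apply/funext => p.
  by rewrite /fscale !fctE /GRing.scale/=; ring.
Qed.

Lemma bilinearB S S' : bilinear_map A S -> bilinear_map A S' ->
  bilinear_map A (fun X Y => S X Y - S' X Y).
Proof.
move=> [Sl Sr] [Sl' Sr']; split=> Z vZ; split=> [X vX|f X Y sf vX vY].
- by apply: vfieldB => //; [exact: (Sl _ vZ).1|exact: (Sl' _ vZ).1].
- rewrite (Sl _ vZ).2 // (Sl' _ vZ).2 //; apply/funext => h; apply/funext => p.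
  by rewrite /fscale !fctE; ring.
- by apply: vfieldB => //; [exact: (Sr _ vZ).1|exact: (Sr' _ vZ).1].
- rewrite (Sr _ vZ).2 // (Sr' _ vZ).2 //; apply/funext => h; apply/funext => p.
  by rewrite /fscale !fctE; ring.
Qed.

Lemma bilinearC S : bilinear_map A S -> bilinear_map A (fun X Y => S Y X).
Proof. by case. Qed.

Lemma bilinear_compl S J : bilinear_map A S -> endomorphism A J ->
  bilinear_map A (fun X Y => S (J X) Y).
Proof.
move=> [Sl Sr] [Jv JD]; split=> Z vZ; last exact/Sr/Jv.
split=> [X vX|f X Y sf vX vY]; first exact/(Sl _ vZ).1/Jv.
by rewrite JD // (Sl _ vZ).2 //; exact: Jv.
Qed.

Lemma bilinear_compr S J : bilinear_map A S -> endomorphism A J ->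
  bilinear_map A (fun X Y => S X (J Y)).
Proof. by move=> Sb Je; exact/bilinearC/(bilinear_compl (bilinearC Sb)). Qed.

Lemma connectionB D S : connection A D -> bilinear_map A S ->
  connection A (fun X Y => D X Y - S X Y).
Proof.
move=> [Dv Dl Da Dr] [Sl Sr].
split=> [X Y vX vY|f X Y Z sf vX vY vZ|X Y Z vX vY vZ|f X Y sf vX vY].
- by apply: vfieldB => //; [exact: Dv|exact: (Sr _ vX).1].
- rewrite Dl // (Sl _ vZ).2 //; apply/funext => h; apply/funext => p.
  by rewrite /fscale !fctE; ring.
- by rewrite Da // (endoD (Sr _ vX)) // opprD addrACA.
- rewrite Dr // (endo_fscale (Sr _ vX)) //; apply/funext => h;
  apply/funext => p.
  by rewrite /fscale !fctE; ring.
Qed.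

Section Connection.
Variable D : operator -> operator -> operator.
Hypothesis DA : connection A D.

Lemma connection_vfield X Y : vfield A X -> vfield A Y -> vfield A (D X Y).
Proof. by case: DA => Dv _ _ _; exact: Dv. Qed.

Lemma connection_endo Y : vfield A Y -> endomorphism A (D ^~ Y).
Proof.
case: DA => Dv Dl _ _ vY; split=> [X vX|f X Z sf vX vZ]; first exact: Dv.
exact: Dl.
Qed.

Lemma connectionZr a X Y : vfield A X -> vfield A Y ->
  D X (a *: Y) = a *: D X Y.
Proof.
case: DA => _ _ _ Dr vX vY; rewrite -[a *: Y]/(fscale (cst a) Y) Dr //;
  last exact: smooth_cst.
rewrite (vfield_cst _ vX); apply/funext => h; apply/funext => p.
by rewrite /fscale !fctE /cst /= mul0r add0r.
Qed.

Lemma nabla_tensor11_bilinear J : endomorphism A J ->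
  bilinear_map A (nabla_tensor11 D J).
Proof.
case: DA => Dv Dl Da Dr Je; have [Jv JD] := Je.
split=> Z vZ; split=> [X vX|f X Y sf vX vY]; rewrite /nabla_tensor11.
- by apply: vfieldB => //; [exact/Dv/Jv|exact/Jv/Dv].
- rewrite !Dl //; try exact: Jv.
  rewrite JD //; try exact: Dv.
  by apply/funext => h; apply/funext => p; rewrite /fscale !fctE; ring.
- by apply: vfieldB => //; [exact/Dv/Jv|exact/Jv/Dv].
- have vJX := Jv _ vX; have vJY := Jv _ vY.
  have vfX := vfield_fscale oA sf vX; have vDX := Dv _ _ vZ vX.
  have vfDX := vfield_fscaleD oA sf vDX (Dv _ _ vZ vY).
  rewrite (JD f X Y) // Da //; last exact: vfield_fscale.
  rewrite Da // !Dr // -(addrA _ (fscale f (D Z X))).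
  rewrite (JD (Z f) X) //; last exact: vfield_smooth.
  rewrite (JD f (D Z X)) //; last exact: Dv.
  by apply/funext => h; apply/funext => p; rewrite /fscale !fctE; ring.
Qed.

(** The Kobayashi-Nomizu connection differs from [D] by a tensor built from the
    covariant derivative of [J]. *)
Lemma kobayashi_nomizu_connection J : endomorphism A J ->
  connection A (kobayashi_nomizu D J).
Proof.
move=> Je; have Nb := nabla_tensor11_bilinear Je.
apply: connectionB; first apply: connectionB => //.
  exact: (bilinearZ _ (bilinear_compr Nb Je)).
apply/bilinearZ/bilinearB; apply: bilinearC.
  exact: bilinear_compr.
exact: bilinear_compl.
Qed.

(** The two corrections collapse on eigenvectors of [J].  The two useful cases
    are [a = b] and [a = - b] below. *)
Lemma kobayashi_nomizu_eigen J a b X Y : endomorphism A J ->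
  a * a = 1 -> b * b = 1 -> vfield A X -> vfield A Y ->
  J X = a *: X -> J Y = b *: Y ->
  kobayashi_nomizu D J X Y =
    2^-1 *: (D X Y + b *: J (D X Y)) -
    4^-1 *: ((1 - b * a) *: D Y X + (b - a) *: J (D Y X)).
Proof.
move=> Je aa bb vX vY JX JY.
have vXY := connection_vfield vX vY; have vYX := connection_vfield vY vX.
rewrite /kobayashi_nomizu /canonical_connection /nabla_tensor11 JX JY.
have DbY Z : vfield A Z -> D (b *: Y) Z = b *: D Y Z.
  by move=> vZ; exact: (endoZ (connection_endo vZ) b vY).
have vbY := vfieldZ oA b vY.
rewrite (endoZ Je _ vX) (endoZ Je _ vY) JX JY !scalerA aa bb !scale1r.
rewrite !connectionZr // !DbY // !(endoZ Je _ vYX).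
rewrite (endoZ Je _ vXY).
apply/funext => h; apply/funext => p; rewrite !fctE /GRing.scale/=; by field.
Qed.

Lemma kobayashi_nomizu_same J b X Y : endomorphism A J -> b * b = 1 ->
  vfield A X -> vfield A Y -> J X = b *: X -> J Y = b *: Y ->
  kobayashi_nomizu D J X Y = 2^-1 *: (D X Y + b *: J (D X Y)).
Proof.
move=> Je bb vX vY JX JY; rewrite (kobayashi_nomizu_eigen Je bb bb) // bb.
by rewrite !subrr !scale0r addr0 scaler0 subr0.
Qed.

(** The combination of the two derivatives is the torsion-free one, so that [D]
    disappears and the right-hand side is the projection of the bracket on the
    eigenspace of [Y]. *)
Lemma kobayashi_nomizu_opposite J b X Y : endomorphism A J -> b * b = 1 ->
  vfield A X -> vfield A Y -> J X = - b *: X -> J Y = b *: Y ->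
  D X Y - D Y X = lie_bracket X Y ->
  kobayashi_nomizu D J X Y =
    2^-1 *: (lie_bracket X Y + b *: J (lie_bracket X Y)).
Proof.
move=> Je bb vX vY JX JY <-.
have vXY := connection_vfield vX vY; have vYX := connection_vfield vY vX.
have NN : - b * - b = 1 by rewrite mulrNN.
rewrite (kobayashi_nomizu_eigen Je NN bb) // mulrN bb opprK.
rewrite (endoB Je vXY vYX).
apply/funext => h; apply/funext => p; rewrite !fctE /GRing.scale/=; by field.
Qed.
End Connection.
End Tensors.

(** * Frames, exterior derivative, curvature in a frame *)

Section Frames.
Context {R : realType} {n : nat} {M : topologicalType} {A : set (chart R n M)}.
Hypothesis oA : forall c, A c -> open (cimg c).
Local Notation operator := ((M -> R) -> (M -> R)).
Implicit Types (f h : M -> R) (X Y Z : operator) (a : R).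

(** The exterior derivative: unlike the bracket it is tensorial, so that it is
    determined by its values on a frame. *)
Definition d_form (t : operator -> M -> R) X Y : M -> R :=
  X (t Y) - Y (t X) - t (lie_bracket X Y).

Lemma d_formC t X Y : one_form A t -> vfield A X -> vfield A Y ->
  d_form t X Y = - d_form t Y X.
Proof.
move=> tA vX vY; rewrite /d_form lie_bracketC (one_formN tA);
  last exact: vfield_bracket.
by rewrite opprK !opprD !opprK (addrC (- _)).
Qed.

Lemma d_form_one_form t Y : one_form A t -> vfield A Y ->
  one_form A (d_form t ^~ Y).
Proof.
move=> tA vY; have ts X : vfield A X -> smooth A (t X) by apply: tA.1.
split=> [X vX|f X Z sf vX vZ].
  apply: smoothB => //; last exact/ts/vfield_bracket.
  by apply: smoothB => //; exact: vfield_smooth.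
have vXY := vfield_bracket oA vX vY; have vZY := vfield_bracket oA vZ vY.
have vfXZ := vfield_fscaleD oA sf vXY vZY.
rewrite /d_form (lie_bracket_fscaleD oA sf vX vZ vY) (one_formB oA tA) //;
  last first.
  by apply: vfield_fscale => //; exact: vfield_smooth.
rewrite (tA.2 _ _ _ sf vXY vZY) (tA.2 _ _ _ sf vX vZ).
rewrite (one_form_fscale tA (vfield_smooth f vY) vX).
rewrite (vfield_add vY (smoothM oA sf (ts _ vX)) (ts _ vZ)).
rewrite (vfield_leibniz vY sf (ts _ vX)).
by apply/funext => p; rewrite /fscale !fctE; ring.
Qed.

(** The coframe is a separate datum; in the application it consists of the
    inner products with the frame, up to the sign of a timelike vector. *)
Record dual_frame (e1 e2 e3 : operator)
    (t1 t2 t3 : operator -> M -> R) : Prop := DualFrame {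
    frame_vfield : [/\ vfield A e1, vfield A e2 & vfield A e3];
    coframe_form : [/\ one_form A t1, one_form A t2 & one_form A t3];
    coframe_e1 : [/\ t1 e1 = 1, t2 e1 = 0 & t3 e1 = 0];
    coframe_e2 : [/\ t1 e2 = 0, t2 e2 = 1 & t3 e2 = 0];
    coframe_e3 : [/\ t1 e3 = 0, t2 e3 = 0 & t3 e3 = 1];
    frame_expansion : forall X, vfield A X ->
      X = fscale (t1 X) e1 + fscale (t2 X) e2 + fscale (t3 X) e3 }.

Section DualFrame.
Variables (e1 e2 e3 : operator) (t1 t2 t3 : operator -> M -> R).
Hypothesis fr : dual_frame e1 e2 e3 t1 t2 t3.

Lemma one_form_frame t X : one_form A t -> vfield A X ->
  t X = t1 X * t e1 + t2 X * t e2 + t3 X * t e3.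
Proof.
case: fr => -[v1 v2 v3] [f1 f2 f3] _ _ _ exp tA vX.
rewrite {1}(exp _ vX) -addrA tA.2 ?tA.2 ?(one_form_fscale tA) ?addrA //;
  do ?[exact: f1.1|exact: f2.1|exact: f3.1].
- by apply: vfield_fscale => //; exact: f3.1.
- apply: vfield_fscaleD => //; first exact: f2.1.
  by apply: vfield_fscale => //; exact: f3.1.
Qed.

Lemma endo_frame T X : endomorphism A T -> vfield A X ->
  T X = fscale (t1 X) (T e1) + fscale (t2 X) (T e2) + fscale (t3 X) (T e3).
Proof.
case: fr => -[v1 v2 v3] [f1 f2 f3] _ _ _ exp TA vX.
rewrite {1}(exp _ vX) -addrA TA.2 ?TA.2 ?(endo_fscale TA) ?addrA //;
  do ?[exact: f1.1|exact: f2.1|exact: f3.1].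
- by apply: vfield_fscale => //; exact: f3.1.
- apply: vfield_fscaleD => //; first exact: f2.1.
  by apply: vfield_fscale => //; exact: f3.1.
Qed.

Lemma coframe_comb x1 x2 x3 : smooth A x1 -> smooth A x2 -> smooth A x3 ->
  let X := fscale x1 e1 + fscale x2 e2 + fscale x3 e3 in
  [/\ t1 X = x1, t2 X = x2 & t3 X = x3].
Proof.
case: fr => -[v1 v2 v3] [f1 f2 f3] [e11 e21 e31] [e12 e22 e32] [e13 e23 e33] _.
move=> s1 s2 s3 /=; have w1 := vfield_fscale oA s1 v1.
have w3 := vfield_fscale oA s3 v3; have w23 := vfield_fscaleD oA s2 v2 w3.
split; rewrite -addrA.
- rewrite f1.2 // f1.2 // (one_form_fscale f1) // e11 e12 e13.
  by rewrite mulr1 !mulr0 !addr0.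
- rewrite f2.2 // f2.2 // (one_form_fscale f2) // e21 e22 e23.
  by rewrite mulr1 !mulr0 !addr0 add0r.
- rewrite f3.2 // f3.2 // (one_form_fscale f3) // e31 e32 e33.
  by rewrite mulr1 !mulr0 !add0r.
Qed.

Lemma proj_plus J X : endomorphism A J ->
  J e1 = e1 -> J e2 = e2 -> J e3 = - e3 -> vfield A X ->
  X + J X = 2 *: (fscale (t1 X) e1 + fscale (t2 X) e2).
Proof.
move=> Je J1 J2 J3 vX; rewrite (endo_frame Je vX) J1 J2 J3.
rewrite {1}(frame_expansion fr vX); apply/funext => h; apply/funext => p.
by rewrite /fscale !fctE /GRing.scale/=; ring.
Qed.

Lemma proj_minus J X : endomorphism A J ->
  J e1 = e1 -> J e2 = e2 -> J e3 = - e3 -> vfield A X ->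
  X - J X = 2 *: fscale (t3 X) e3.
Proof.
move=> Je J1 J2 J3 vX; rewrite (endo_frame Je vX) J1 J2 J3.
rewrite {1}(frame_expansion fr vX); apply/funext => h; apply/funext => p.
by rewrite /fscale !fctE /GRing.scale/=; ring.
Qed.

(** Connections with connection form theta_3 (x) S, where S e1 = beta e2,
    S e2 = - alpha e1 and S e3 = 0. *)
Section RotationConnection.
Variables (alpha beta : R) (D : operator -> operator -> operator).
Hypothesis DA : connection A D.
Hypothesis D1 : [/\ D e1 e1 = 0, D e1 e2 = 0 & D e1 e3 = 0].
Hypothesis D2 : [/\ D e2 e1 = 0, D e2 e2 = 0 & D e2 e3 = 0].
Hypothesis D3 : [/\ D e3 e1 = beta *: e2, D e3 e2 = - alpha *: e1 &
  D e3 e3 = 0].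

Lemma connection_coords X Y : vfield A X -> vfield A Y ->
  [/\ t1 (D X Y) = X (t1 Y) - alpha *: (t3 X * t2 Y),
      t2 (D X Y) = X (t2 Y) + beta *: (t3 X * t1 Y) &
      t3 (D X Y) = X (t3 Y)].
Proof.
move=> vX vY; have [[v1 v2 v3] [f1 f2 f3] _ _ _ exp] := fr.
have [_ Dl Da Dr] := DA.
have [D11 D12 D13] := D1; have [D21 D22 D23] := D2; have [D31 D32 D33] := D3.
have sX u := vfield_smooth u vX.
have [s1 s2 s3] : [/\ smooth A (t1 Y), smooth A (t2 Y) & smooth A (t3 Y)].
  by split; [exact: f1.1|exact: f2.1|exact: f3.1].
have w1 := vfield_fscale oA s1 v1; have w2 := vfield_fscale oA s2 v2.
have w3 := vfield_fscale oA s3 v3.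
have DXY : D X Y =
    fscale (X (t1 Y) - alpha *: (t3 X * t2 Y)) e1 +
    fscale (X (t2 Y) + beta *: (t3 X * t1 Y)) e2 + fscale (X (t3 Y)) e3.
  rewrite {1}(exp _ vY) !Da //; last exact: vfieldD.
  rewrite !Dr // (endo_frame (connection_endo DA v1) vX).
  rewrite (endo_frame (connection_endo DA v2) vX).
  rewrite (endo_frame (connection_endo DA v3) vX).
  rewrite D11 D12 D13 D21 D22 D23 D31 D32 D33.
  have z h p : (0 : operator) h p = 0 by [].
  apply/funext => h; apply/funext => p.
  by rewrite /fscale !fctE /GRing.scale/= !z; ring.
rewrite DXY; apply: coframe_comb => //.
- by apply/smoothB/smoothZ/smoothM => //; exact: f3.1.
- by apply/smoothD/smoothZ/smoothM => //; exact: f3.1.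
Qed.

(** The quadratic part of the curvature vanishes since the connection form takes
    its values in the multiples of a single endomorphism S: what remains is
    d theta_3 (x) S. *)
Lemma curvature_coords X Y Z : vfield A X -> vfield A Y -> vfield A Z ->
  [/\ t1 (curvature D X Y Z) = - alpha *: (d_form t3 X Y * t2 Z),
      t2 (curvature D X Y Z) = beta *: (d_form t3 X Y * t1 Z) &
      t3 (curvature D X Y Z) = 0].
Proof.
move=> vX vY vZ; have [_ [f1 f2 f3] _ _ _ _] := fr.
have cv U V := @connection_vfield _ _ _ A D DA U V.
have vYZ := cv _ _ vY vZ; have vXZ := cv _ _ vX vZ.
have vXYZ := cv _ _ vX vYZ; have vYXZ := cv _ _ vY vXZ.
have vB := vfield_bracket oA vX vY; have vBZ := cv _ _ vB vZ.
have vS := vfieldB oA vXYZ vYXZ.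
have [X1 X2 X3] := connection_coords vX vYZ.
have [Y1 Y2 Y3] := connection_coords vY vXZ.
have [B1 B2 B3] := connection_coords vB vZ.
have [YZ1 YZ2 YZ3] := connection_coords vY vZ.
have [XZ1 XZ2 XZ3] := connection_coords vX vZ.
have [z1 z2 z3] : [/\ smooth A (t1 Z), smooth A (t2 Z) & smooth A (t3 Z)].
  by split; [exact: f1.1|exact: f2.1|exact: f3.1].
have x3 := f3.1 _ vX; have y3 := f3.1 _ vY.
have W a U u k l : vfield A U -> smooth A u -> smooth A k -> smooth A l ->
    U (u + a *: (k * l)) = U u + a *: (k * U l + l * U k).
  move=> vU su sk sl; rewrite (vfield_add vU) //; last exact/smoothZ/smoothM.
  by rewrite (vfield_scale _ vU) ?(vfield_leibniz vU) //; exact: smoothM.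
have sY u := vfield_smooth u vY; have sX u := vfield_smooth u vX.
rewrite /curvature !(one_formB oA f1) // !(one_formB oA f2) //.
rewrite !(one_formB oA f3) // X1 X2 X3 Y1 Y2 Y3 B1 B2 B3 YZ1 YZ2 YZ3 XZ1 XZ2
  XZ3.
rewrite -!scaleNr.
rewrite (W _ X _ _ _ vX (sY _) y3 z2) (W _ Y _ _ _ vY (sX _) x3 z2).
rewrite (W _ X _ _ _ vX (sY _) y3 z1) (W _ Y _ _ _ vY (sX _) x3 z1).
have z p : (0 : M -> R) p = 0 by [].
split; apply/funext => p;
  by rewrite /d_form /lie_bracket !fctE /GRing.scale/= ?z; ring.
Qed.

Variable gamma : R.
Hypothesis e12 : lie_bracket e1 e2 = - gamma *: e3.
Hypothesis e13 : lie_bracket e1 e3 = - beta *: e2.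
Hypothesis e23 : lie_bracket e2 e3 = alpha *: e1.

(** By the structure equations, theta_3([e_i, e_j]) can be nonzero only
    for {i, j} = {1, 2}. *)
Lemma d_coframe3 X : vfield A X ->
  d_form t3 X e1 = - gamma *: t2 X /\ d_form t3 X e2 = gamma *: t1 X.
Proof.
move=> vX; have [[v1 v2 v3] [f1 f2 f3] [_ _ t31] [_ _ t32] [_ _ t33] _] := fr.
have d0 e e' a b : vfield A e -> vfield A e' -> t3 e = cst a -> t3 e' = cst b ->
    d_form t3 e e' = - t3 (lie_bracket e e').
  move=> ve ve' te te';
    rewrite /d_form te te' (vfield_cst _ ve) (vfield_cst _ ve').
  by rewrite subrr sub0r.
have bb U : lie_bracket U U = 0 by apply/funext => h; exact: subrr.
have t30 : t3 0 = 0 by exact: one_form0 f3.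
have d11 : d_form t3 e1 e1 = 0 by rewrite (d0 _ _ 0 0) // bb t30 oppr0.
have d22 : d_form t3 e2 e2 = 0 by rewrite (d0 _ _ 0 0) // bb t30 oppr0.
have d12 : d_form t3 e1 e2 = gamma *: (1 : M -> R).
  by rewrite (d0 _ _ 0 0) // e12 (one_formZ f3) // t33 scaleNr opprK.
have d13 : d_form t3 e1 e3 = 0.
  by rewrite (d0 _ _ 0 1) // e13 (one_formZ f3) // t32 scaler0 oppr0.
have d23 : d_form t3 e2 e3 = 0.
  by rewrite (d0 _ _ 0 1) // e23 (one_formZ f3) // t31 scaler0 oppr0.
have dC U V vU vV := @d_formC t3 U V f3 vU vV.
rewrite (one_form_frame (d_form_one_form f3 v1) vX).
rewrite (one_form_frame (d_form_one_form f3 v2) vX).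
rewrite (dC _ _ v2 v1) (dC _ _ v3 v1) (dC _ _ v3 v2) d11 d12 d13 d22 d23.
have z p : (0 : M -> R) p = 0 by [].
have o p : (1 : M -> R) p = 1 by [].
by split; apply/funext => p; rewrite !fctE /GRing.scale/= ?z ?o; ring.
Qed.

(** The Ricci tensor in coordinates, as [ricci_diagonal] shows. *)
Definition diagonal_form X Y : M -> R :=
  - gamma *: (beta *: (t1 X * t1 Y) + alpha *: (t2 X * t2 Y)).

Lemma ricci_diagonal X Y : vfield A X -> vfield A Y ->
  - t1 (curvature D X e1 Y) - t2 (curvature D X e2 Y) - t3 (curvature D X e3 Y)
  = diagonal_form X Y.
Proof.
move=> vX vY; have [[v1 v2 v3] _ _ _ _ _] := fr.
have [-> _ _] := curvature_coords vX v1 vY.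
have [_ -> _] := curvature_coords vX v2 vY.
have [_ _ ->] := curvature_coords vX v3 vY.
have [-> ->] := d_coframe3 vX.
have z p : (0 : M -> R) p = 0 by [].
by apply/funext => p; rewrite /diagonal_form !fctE /GRing.scale/= !z; ring.
Qed.

Lemma diagonal_form_tensor : tensor02 A diagonal_form.
Proof.
have [_ [f1 f2 _] _ _ _ _] := fr; rewrite /diagonal_form.
split=> [X Y vX vY|f X Y Z sf vX vY vZ|f X Y Z sf vX vY vZ].
- by apply: smoothZ => //; apply: smoothD => //; apply: smoothZ => //;
    apply: smoothM => //; (exact: f1.1 || exact: f2.1).
- rewrite f1.2 // f2.2 //; apply/funext => p.
  by rewrite !fctE /GRing.scale/=; ring.
- rewrite f1.2 // f2.2 //; apply/funext => p.
  by rewrite !fctE /GRing.scale/=; ring.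
Qed.

(** The derivatives of the coordinates cancel by the Leibniz rule.  What is left
    is the form evaluated on S Y, Z and on Y, S Z, and S is skew for it: the
    terms in alpha beta cancel. *)
Lemma diagonal_form_parallel X Y Z : vfield A X -> vfield A Y -> vfield A Z ->
  nabla_tensor02 D diagonal_form X Y Z = 0.
Proof.
move=> vX vY vZ; have [_ [f1 f2 _] _ _ _ _] := fr.
rewrite /nabla_tensor02 /diagonal_form.
have [-> -> _] := connection_coords vX vY.
have [-> -> _] := connection_coords vX vZ.
have [y1 y2] := (f1.1 _ vY, f2.1 _ vY); have [z1 z2] := (f1.1 _ vZ, f2.1 _ vZ).
have s1 := smoothM oA y1 z1; have s2 := smoothM oA y2 z2.
have b1 := smoothZ oA beta s1; have a2 := smoothZ oA alpha s2.
rewrite (vfield_scale _ vX (smoothD oA b1 a2)) (vfield_add vX b1 a2).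
rewrite (vfield_scale _ vX s1) (vfield_scale _ vX s2).
rewrite (vfield_leibniz vX y1 z1) (vfield_leibniz vX y2 z2).
have z p : (0 : M -> R) p = 0 by [].
by apply/funext => p; rewrite !fctE /GRing.scale/= z; ring.
Qed.
End RotationConnection.
End DualFrame.

(** Both terms of the Codazzi equation vanish.  The form [w] is compared with
    [w'] on vector fields only, because formulas in a frame say nothing about
    operators that are not vector fields. *)
Lemma parallel_codazzi (D : operator -> operator -> operator) w w' :
  connection A D ->
  (forall X Y, vfield A X -> vfield A Y -> w X Y = w' X Y) ->
  tensor02 A w' ->
  (forall X Y Z, vfield A X -> vfield A Y -> vfield A Z ->
     nabla_tensor02 D w' X Y Z = 0) ->
  codazzi_tensor A D w.
Proof.
move=> DA ww' [w's w'l w'r] par.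
have par_w X Y Z : vfield A X -> vfield A Y -> vfield A Z ->
    nabla_tensor02 D w X Y Z = 0.
  move=> vX vY vZ; rewrite -[RHS](par X Y Z) // /nabla_tensor02 !ww' //;
  exact: (connection_vfield DA).
split; last by move=> X Y Z vX vY vZ; rewrite !par_w // subrr.
split=> [X Y vX vY|f X Y Z sf vX vY vZ|f X Y Z sf vX vY vZ].
- by rewrite ww'; first exact: w's.
- by rewrite !ww' ?w'l //; exact: vfield_fscaleD.
- by rewrite !ww' ?w'r //; exact: vfield_fscaleD.
Qed.
End Frames.

(** * The Kobayashi-Nomizu connection in a pseudo-orthonormal frame *)

Section LorentzFrame.
Context {R : realType} {n : nat} {M : topologicalType} {A : set (chart R n M)}.
Hypothesis oA : forall c, A c -> open (cimg c).
Local Notation functional := ((M -> R) -> R).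
Local Notation operator := ((M -> R) -> (M -> R)).
Variable g : M -> functional -> functional -> R.
Hypothesis gA : lorentz_metric3 A g.
Implicit Types (X Y Z : operator).

Lemma metric_onC X Y : vfield A X -> vfield A Y ->
  metric_on g X Y = metric_on g Y X.
Proof.
case: gA => _ gC _ _ vX vY; apply/funext => p.
by apply: gC; [exact: vX.1|exact: vY.1].
Qed.

Lemma metric_on_one_form Y : vfield A Y -> one_form A (metric_on g ^~ Y).
Proof.
case: gA => gl _ _ gs vY; split=> [X vX|f X Z sf vX vZ]; first exact: gs.
by apply/funext => p; apply: gl; [exact: vX.1|exact: vZ.1|exact: vY.1].
Qed.

Lemma one_form_opp t : one_form A t -> one_form A (fun X => - t X).
Proof.
move=> tA; split=> [X vX|f X Z sf vX vZ]; first exact/smoothN/tA.1.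
by rewrite tA.2 // opprD mulrN.
Qed.

Lemma tangent_comb p a u v : tangent A p u -> tangent A p v ->
  tangent A p (a *: u + v).
Proof.
move=> [ul uM u0] [vl vM v0]; split=> [b f h sf sh|f h sf sh|f nf];
  rewrite !fctE /GRing.scale/=.
- by rewrite ul // vl // ; ring.
- by rewrite uM // vM //; ring.
- by rewrite u0 // v0 // mulr0 addr0.
Qed.

Variables e1 e2 e3 : operator.
Hypothesis e_vfield : [/\ vfield A e1, vfield A e2 & vfield A e3].
Hypothesis e_norm : [/\ metric_on g e1 e1 = cst 1, metric_on g e2 e2 = cst 1 &
  metric_on g e3 e3 = cst (-1)].
Hypothesis e_orth : [/\ metric_on g e1 e2 = cst 0, metric_on g e1 e3 = cst 0 &
  metric_on g e2 e3 = cst 0].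

(** The sign in the third coordinate comes from [e3] being timelike. *)
Lemma pseudo_orthonormal_frame :
  dual_frame (A := A) e1 e2 e3 (metric_on g ^~ e1) (metric_on g ^~ e2)
    (fun X => - metric_on g X e3).
Proof.
have [v1 v2 v3] := e_vfield; have [n1 n2 n3] := e_norm.
have [q12 q13 q23] := e_orth.
have oC (X Y : operator) : vfield A X -> vfield A Y ->
  metric_on g X Y = cst 0 ->
  metric_on g Y X = cst 0 by move=> vX vY <-; exact: metric_onC.
have q21 := oC _ _ v1 v2 q12; have q31 := oC _ _ v1 v3 q13.
have q32 := oC _ _ v2 v3 q23.
split; first by [].
- by split; [| |apply: one_form_opp]; exact: metric_on_one_form.
- by split=> //; rewrite q13 oppr0.
- by split=> //; rewrite q23 oppr0.
- by split=> //; rewrite n3; apply/funext => p; exact: opprK.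
move=> X vX.
suff XE : forall p, value_at X p = metric_on g X e1 p *: value_at e1 p +
    metric_on g X e2 p *: value_at e2 p +
    (- metric_on g X e3 p) *: value_at e3 p.
  by apply/funext => h; apply/funext => p; exact: (congr1 (@^~ h) (XE p)).
move=> p; have [gl gC gb _] := gA.
have [b1 [b2 [b3 [[tb1 tb2 tb3 spanb] [nb1 nb2 nb3 [p12 p13 p23]]]]]] := gb p.
(* Triples as families indexed by 'I_3; the default value [z] is never
   reached beyond index 2. *)
pose pick T (x y z : T) (i : 'I_3) := nth z [:: x; y; z] i.
have pickP T (P : T -> Prop) x y z : P x -> P y -> P z ->
  forall i, P (pick T x y z i).
  by move=> Px Py Pz [[|[|[|]]]].
have pickP2 (x y z : functional) : g p x x = 1 -> g p y y = 1 -> g p z z = -1 ->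
    tangent A p x -> tangent A p y -> tangent A p z ->
    g p x y = 0 -> g p x z = 0 -> g p y z = 0 ->
    forall i j, g p (pick _ x y z i) (pick _ x y z j) =
      pick R 1 1 (-1) i *+ (i == j).
  move=> gx gy gz tx ty tz gxy gxz gyz [[|[|[|i]]] Hi] [[|[|[|j]]] Hj] //=;
  by rewrite /pick /= ?gx ?gy ?gz ?gxy ?gxz ?gyz // gC.
have := @pseudo_orthonormal_expansion R functional (tangent A p) (g p) 3
  (pick R 1 1 (-1)) (pick functional b1 b2 b3)
  (pick functional (value_at e1 p) (value_at e2 p) (value_at e3 p)).
have t0 : tangent A p 0 by exact: (vfield0 (A := A)).1.
move=> /(_ t0 (@tangent_comb p) (gl p) (gC p)) E.
have tX := vX.1 p; have te1 := v1.1 p; have te2 := v2.1 p; have te3 := v3.1 p.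
have at_p (U V : operator) a : metric_on g U V = cst a ->
  g p (value_at U p) (value_at V p) = a by move=> /(congr1 (@^~ p)).
rewrite (E _ _ _ _ _ _ _ tX).
- rewrite !big_ord_recl big_ord0 addr0 addrA.
  by rewrite /pick /= !mul1r mulN1r.
- exact: pickP.
- exact: pickP.
- move=> v /spanb[c [-> _]]; exists (pick R c.1.1 c.1.2 c.2).
  by rewrite !big_ord_recl big_ord0 addr0 addrA.
- by apply: (pickP _ (fun x : R => x * x = 1)); rewrite ?mulrNN mulr1.
- exact: pickP2.
- by apply: pickP2 => //; exact: at_p.
Qed.

Variables (alpha beta gamma : R) (D : operator -> operator -> operator)
  (J : operator -> operator).
Hypothesis LC : levi_civita A g D.
Hypothesis JA : endomorphism A J.
Hypothesis Je : [/\ J e1 = e1, J e2 = e2 & J e3 = - e3].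
Hypothesis e12 : lie_bracket e1 e2 = - gamma *: e3.
Hypothesis e13 : lie_bracket e1 e3 = - beta *: e2.
Hypothesis e23 : lie_bracket e2 e3 = alpha *: e1.

(** Constant inner products make the connection coefficients skew. *)
Lemma metric_compat_cst X Y Z a : vfield A X -> vfield A Y -> vfield A Z ->
  metric_on g Y Z = cst a ->
  metric_on g (D X Y) Z = - metric_on g (D X Z) Y.
Proof.
case: LC => [DA _ Dg] vX vY vZ gYZ.
have := Dg X Y Z vX vY vZ; rewrite gYZ (vfield_cst _ vX) => /esym/eqP.
rewrite (metric_onC vY (connection_vfield DA vX vZ)).
by rewrite -[cst 0]/(0 : M -> R) addr_eq0 => /eqP.
Qed.

Lemma metric_compat_unit X Y a : vfield A X -> vfield A Y ->
  metric_on g Y Y = cst a -> metric_on g (D X Y) Y = 0.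
Proof.
move=> vX vY gYY; apply/funext => p.
have := congr1 (@^~ p) (metric_compat_cst vX vY vY gYY).
rewrite fctE => /eqP; rewrite -addr_eq0 -mulr2n mulrn_eq0 /= => /eqP.
by [].
Qed.

(** Moving the derivative from one index to another by skewness and by torsion
    freeness ends at a coefficient of the form g(D_X Y, Y), which vanishes; the
    torsion term does not interfere because [e1, e2] is orthogonal to the plane
    of [e1] and [e2]. *)
Lemma levi_civita_plane :
  [/\ metric_on g (D e1 e1) e2 = 0, metric_on g (D e1 e2) e1 = 0,
      metric_on g (D e2 e1) e2 = 0 & metric_on g (D e2 e2) e1 = 0].
Proof.
have [v1 v2 v3] := e_vfield; have [n1 n2 n3] := e_norm.
have [q12 q13 q23] := e_orth; have [DA Dt _] := LC.
have w12 := connection_vfield DA v1 v2; have w21 := connection_vfield DA v2 v1.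
have f1 := metric_on_one_form v1; have f2 := metric_on_one_form v2.
have q31 : metric_on g e3 e1 = 0 by rewrite metric_onC.
have q32 : metric_on g e3 e2 = 0 by rewrite metric_onC.
have E12 : D e1 e2 = D e2 e1 + - gamma *: e3.
  by rewrite -e12 -Dt // addrC subrK.
have E1 : metric_on g (D e1 e2) e1 = 0.
  rewrite E12 (one_formD f1) ?(one_formZ f1) //; last exact: vfieldZ.
  by rewrite q31 scaler0 addr0 (metric_compat_unit v2 v1 n1).
have E2 : metric_on g (D e2 e1) e2 = 0.
  have := metric_compat_unit v1 v2 n2.
  rewrite E12 (one_formD f2) ?(one_formZ f2) //; last exact: vfieldZ.
  by rewrite q32 scaler0 addr0.
split=> //.
- by rewrite (metric_compat_cst v1 v1 v2 q12) E1 oppr0.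
- have q21 : metric_on g e2 e1 = cst 0 by rewrite metric_onC.
  by rewrite (metric_compat_cst v2 v2 v1 q21) E2 oppr0.
Qed.

Lemma kobayashi_nomizu_frame (K := kobayashi_nomizu D J) :
  [/\ [/\ K e1 e1 = 0, K e1 e2 = 0 & K e1 e3 = 0],
      [/\ K e2 e1 = 0, K e2 e2 = 0 & K e2 e3 = 0] &
      [/\ K e3 e1 = beta *: e2, K e3 e2 = - alpha *: e1 & K e3 e3 = 0]].
Proof.
have fr := pseudo_orthonormal_frame; have [DA Dt _] := LC.
have [v1 v2 v3] := e_vfield; have [n1 n2 n3] := e_norm; have [J1 J2 J3] := Je.
have [g112 g121 g212 g221] := levi_civita_plane.
have one : (1 : R) * 1 = 1 by rewrite mulr1.
have mone : (-1 : R) * -1 = 1 by rewrite mulrNN mulr1.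
(* The eigenvalue equations, in the forms asked for by the lemmas on equal and
   on opposite eigenvalues. *)
have P1 : J e1 = 1 *: e1 by rewrite scale1r.
have P2 : J e2 = 1 *: e2 by rewrite scale1r.
have P3 : J e3 = -1 *: e3 by rewrite scaleN1r.
have M1 : J e1 = - -1 *: e1 by rewrite opprK scale1r.
have M2 : J e2 = - -1 *: e2 by rewrite opprK scale1r.
have f0 X : fscale 0 X = 0.
  by apply/funext => h; apply/funext => p; rewrite /fscale !fctE mul0r.
have plane i j : vfield A i -> vfield A j -> J i = 1 *: i -> J j = 1 *: j ->
    metric_on g (D i j) e1 = 0 -> metric_on g (D i j) e2 = 0 -> K i j = 0.
  move=> vi vj Ji Jj g1 g2; rewrite /K (kobayashi_nomizu_same oA DA JA one) //.
  rewrite scale1r (proj_plus oA fr JA) //;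
    last exact: connection_vfield DA _ _ _ _.
  by rewrite g1 g2 !f0 addr0 !scaler0.
have half (X : operator) : 2^-1 *: (X + X) = X.
  apply/funext => h; apply/funext => p.
  by rewrite !fctE /GRing.scale/=; field.
have b31 : lie_bracket e3 e1 = beta *: e2.
  by rewrite lie_bracketC e13 scaleNr opprK.
have b32 : lie_bracket e3 e2 = - alpha *: e1.
  by rewrite lie_bracketC e23 scaleNr.
split; split.
- by apply: plane => //; exact: metric_compat_unit n1.
- by apply: plane => //; exact: metric_compat_unit n2.
- rewrite /K (kobayashi_nomizu_opposite oA DA JA mone v1 v3 M1 P3
    (Dt _ _ v1 v3)).
  by rewrite e13 (endoZ JA) // J2 scaleN1r subrr scaler0.
- by apply: plane => //; exact: metric_compat_unit n1.
- by apply: plane => //; exact: metric_compat_unit n2.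
- rewrite /K (kobayashi_nomizu_opposite oA DA JA mone v2 v3 M2 P3
    (Dt _ _ v2 v3)).
  by rewrite e23 (endoZ JA) // J1 scaleN1r subrr scaler0.
- have P3' : J e3 = - (1) *: e3 by rewrite scaleN1r.
  rewrite /K (kobayashi_nomizu_opposite oA DA JA one v3 v1 P3' P1
    (Dt _ _ v3 v1)).
  by rewrite b31 (endoZ JA) // J2 scale1r half.
- have P3' : J e3 = - (1) *: e3 by rewrite scaleN1r.
  rewrite /K (kobayashi_nomizu_opposite oA DA JA one v3 v2 P3' P2
    (Dt _ _ v3 v2)).
  by rewrite b32 (endoZ JA) // J1 scale1r half.
- rewrite /K (kobayashi_nomizu_same oA DA JA mone) // scaleN1r.
  rewrite (proj_minus oA fr JA) //; last exact: connection_vfield DA _ _ _ _.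
  by rewrite (metric_compat_unit v3 v3 n3) oppr0 f0 !scaler0.
Qed.

Lemma symmetrized_ricci_codazzi (K := kobayashi_nomizu D J) :
  codazzi_tensor A K (symmetrized_ricci g e1 e2 e3 K).
Proof.
have fr := pseudo_orthonormal_frame; have [DA _ _] := LC.
have KA := kobayashi_nomizu_connection oA DA JA.
have [K1 K2 K3] := kobayashi_nomizu_frame.
apply: (parallel_codazzi oA KA) (diagonal_form_tensor oA fr alpha beta gamma)
  (diagonal_form_parallel oA fr KA K1 K2 K3 gamma).
have ricciE X Y : vfield A X -> vfield A Y -> ricci g e1 e2 e3 K X Y =
    diagonal_form (metric_on g ^~ e1) (metric_on g ^~ e2) alpha beta gamma X Y.
  move=> vX vY.
  rewrite -(ricci_diagonal oA fr KA K1 K2 K3 e12 e13 e23 vX vY).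
  by rewrite opprK.
move=> X Y vX vY; rewrite /symmetrized_ricci !ricciE //.
apply/funext => p; rewrite /diagonal_form !fctE /GRing.scale/=; by field.
Qed.
End LorentzFrame.

(** Pointwise linearity gives linearity over functions, scalars at a point being
    the values of functions there. *)
Lemma tensor11_endomorphism (R : realType) (n : nat) (M : topologicalType)
    (A : set (chart R n M)) (J : M -> ((M -> R) -> R) -> ((M -> R) -> R)) :
  tensor11 A J -> endomorphism A (apply_tensor11 J).
Proof.
move=> [_ Jl Jv]; split=> [//|f X Y sf vX vY].
apply/funext => h; apply/funext => p.
exact: (congr1 (fun F : (M -> R) -> R => F h)
  (Jl p (f p) _ _ (vX.1 p) (vY.1 p))).
Qed.

Unset Implicit Arguments.

Theorem theorem4p12 (R : realType) (alpha beta gamma : R)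
    (G : topologicalGroupType) (A : set (chart R 3 G))
    (g : G -> ((G -> R) -> R) -> ((G -> R) -> R) -> R)
    (e1 e2 e3 : (G -> R) -> (G -> R))
    (nablaL : ((G -> R) -> (G -> R)) -> ((G -> R) -> (G -> R)) ->
              ((G -> R) -> (G -> R)))
    (J : G -> ((G -> R) -> R) -> ((G -> R) -> R)) :
  is_lie_group A ->
  connected [set: G] ->
  simply_connected R G ->
  lorentz_metric3 A g ->
  left_invariant_metric A g ->
  lie_algebra_basis A e1 e2 e3 ->
  [/\ metric_on g e1 e1 = cst 1, metric_on g e2 e2 = cst 1 &
      metric_on g e3 e3 = cst (-1)] ->
  [/\ metric_on g e1 e2 = cst 0, metric_on g e1 e3 = cst 0 &
      metric_on g e2 e3 = cst 0] ->
  lie_bracket e1 e2 = - gamma *: e3 ->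
  lie_bracket e1 e3 = - beta *: e2 ->
  lie_bracket e2 e3 = alpha *: e1 ->
  levi_civita A g nablaL ->
  tensor11 A J ->
  [/\ apply_tensor11 J e1 = e1, apply_tensor11 J e2 = e2 &
      apply_tensor11 J e3 = - e3] ->
  let nablak := kobayashi_nomizu nablaL (apply_tensor11 J) in
  codazzi_tensor A nablak (symmetrized_ricci g e1 e2 e3 nablak).
Proof.
move=> [[_ chA _ _] _ _] _ _ gA _ [[v1 _] [v2 _] [v3 _] _] en eo e12 e13 e23.
move=> LC /tensor11_endomorphism JA Je.
have oA c : A c -> open (cimg c) by move=> /chA[[_ oc] _ _ _ _].
exact: (symmetrized_ricci_codazzi oA gA (And3 v1 v2 v3) en eo LC JA Je
  e12 e13 e23).
Qed.
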